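(* Let $\Omega$ be any infinite set and let $\mathcal{P}=\{\Sigma_0,\Sigma_1,\ldots,\Sigma_{n-1}\}$, $n\geq 2$, be a finite partition of $\Omega$. Then the maximal subsemigroups of $\Omega^\Omega$ containing $\operatorname{Stab}(\mathcal{P})$ but not containing $\operatorname{Sym}(\Omega)$ are precisely: $$A_1(\mathcal{P})=\{f\in\Omega^\Omega:\rho_f\in\operatorname{Sym}(n)\text{ or }\rho_f\text{ is not total}\},$$ $$A_2(\mathcal{P})=\{f\in\Omega^\Omega:\rho_f\in\operatorname{Sym}(n)\text{ or }\rho_f^{-1}\text{ is not total}\}.$$
   Context: $\Omega^\Omega$ is the semigroup of all mappings from $\Omega$ to itself; mappings are written to the right of their arguments and composed from left to right. $\operatorname{Sym}(\Omega)$ is the symmetric group on $\Omega$. A subsemigroup $T$ of a semigroup $S$ is a maximal subsemigroup if $T\neq S$ and the subsemigroup $\langle T,s\rangle$ generated by $T$ and $s$ equals $S$ for all $s\in S\setminus T$. A finite partition of $\Omega$ is a partition $\{\Sigma_0,\ldots,\Sigma_{n-1}\}$ of $\Omega$ into $n\geq 2$ parts with $|\Sigma_0|=\cdots=|\Sigma_{n-1}|=|\Omega|$. Its stabiliser is $\operatorname{Stab}(\mathcal{P})=\{f\in\operatorname{Sym}(\Omega):(\forall i)(\exists j)(\Sigma_i f=\Sigma_j)\}$. For $f\in\Omega^\Omega$, $\rho_f$ is the binary relation on $n=\{0,1,\ldots,n-1\}$ given by $\rho_f=\{(i,j):|\Sigma_i f\cap\Sigma_j|=|\Omega|\}$. For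 a binary relation $\sigma$, $\sigma^{-1}=\{(i,j):(j,i)\in\sigma\}$; $\sigma$ is total if for every $i$ there is $j$ with $(i,j)\in\sigma$. $\operatorname{Sym}(n)$ is the symmetric group on $\{0,\ldots,n-1\}$, its elements being regarded as binary relations. *)

(* Defs.v *)
From mathcomp Require Import all_boot all_fingroup.
From mathcomp Require Import all_classical.

Set Implicit Arguments.
Unset Strict Implicit.
Unset Printing Implicit Defensive.

Local Open Scope classical_set_scope.
Local Open Scope card_scope.

Definition subsemigroup (S : Type) (op : S -> S -> S) (T : set S) : Prop :=
  forall x y, T x -> T y -> T (op x y).

Definition generated_subsemigroup (S : Type) (op : S -> S -> S) (G : set S) :
  set S := smallest (subsemigroup op) G.

Definition maximal_subsemigroup (S : Type) (op : S -> S -> S) (T : set S) :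
    Prop :=
  [/\ subsemigroup op T, T <> [set: S] &
      forall s, ~ T s -> generated_subsemigroup op (T `|` [set s]) = [set: S]].

(* Mappings act on the right of their arguments, so the product f g means
   "f first, then g". *)
Definition map_mul (Omega : Type) (f g : Omega -> Omega) : Omega -> Omega :=
  g \o f.

Definition SymSet (Omega : Type) : set (Omega -> Omega) :=
  [set f | bijective f].

(* The parts are indexed by 'I_n; they are pairwise distinct because they are
   disjoint and nonempty. *)
Definition finite_partition (Omega : Type) (n : nat)
    (Sigma : 'I_n -> set Omega) : Prop :=
  [/\ (2 <= n)%N, partition [set: 'I_n] Sigma [set: Omega] &
      forall i, Sigma i #= [set: Omega]].

Definition Stab (Omega : Type) (n : nat) (Sigma : 'I_n -> set Omega) :
  set (Omega -> Omega) :=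
  [set f | SymSet f /\ forall i, exists j, f @` Sigma i = Sigma j].

Definition rho (Omega : Type) (n : nat) (Sigma : 'I_n -> set Omega)
    (f : Omega -> Omega) : set ('I_n * 'I_n) :=
  [set ij | (f @` Sigma ij.1) `&` Sigma ij.2 #= [set: Omega]].

Definition rel_total (n : nat) (sigma : set ('I_n * 'I_n)) : Prop :=
  forall i, exists j, sigma (i, j).

Definition perm_rel (n : nat) (s : 'S_n) : set ('I_n * 'I_n) :=
  [set ij | s ij.1 = ij.2].

Definition rel_in_Sym (n : nat) (sigma : set ('I_n * 'I_n)) : Prop :=
  exists s : 'S_n, sigma = perm_rel s.

Definition A1 (Omega : Type) (n : nat) (Sigma : 'I_n -> set Omega) :
  set (Omega -> Omega) :=
  [set f | rel_in_Sym (rho Sigma f) \/ ~ rel_total (rho Sigma f)].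

Definition A2 (Omega : Type) (n : nat) (Sigma : 'I_n -> set Omega) :
  set (Omega -> Omega) :=
  [set f | rel_in_Sym (rho Sigma f) \/
           ~ rel_total ((rho Sigma f)^-1)%relation].

(* Main.v *)
From mathcomp Require Import all_boot all_fingroup.
From mathcomp Require Import all_classical.
Require Import Defs.

Set Implicit Arguments.
Unset Strict Implicit.
Unset Printing Implicit Defensive.

Local Open Scope classical_set_scope.
Local Open Scope card_scope.

(** Call a set big when it has the cardinality of Omega, and write a product
    with its left factor acting first.

    Since finite unions of non-big sets are not big, the relation of a product
    f g is contained in the product of the relations of f and g ([rho_comp]).
    So A1 and A2 are subsemigroups. They contain the stabiliser, whose
    elements induce permutations of the parts, and they miss a bijection whose
    relation is full.

    The rest relies on one observation. The stabiliser of the parts can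
    rearrange each part at will as long as big pieces of each part stay free
    ([extend_to_Stab]). Hence, for a semigroup U above the stabiliser, all
    that matters of an f in U is between which parts it carries big sets
    injectively. [realizes U s d] says that some f in U carries, injectively
    and simultaneously for all t, a big piece of the part s t into the part d
    t; such patterns compose and can be reindexed. If U is not contained in A1
    then some f in U has a total relation that contains a non-injective
    function on the indices. Together with all the permutations it generates a
    constant function ([collapse_to_constant]), so an element of U packs big
    pieces of all parts into a single part ([not_A1_realizes]). Dually, if U
    is not contained in A2, an element of U spreads a single part over all
    parts ([not_A2_realizes]).

    Maximality of A1: with the packing element f, every h factors as alpha f
    beta. Here alpha moves every part into itself, and beta does the work of h
    on the image of alpha f, which misses all parts but one, and is constant
    off that image. Both factors lie in A1. The argument for A2 is dual, with
    the spreading element.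

    Conversely, let M be maximal, above the stabiliser and not above
    Sym(Omega), and suppose that M lies neither in A1 nor in A2. Then M has
    packing and spreading elements. It also has an injection alpha whose image
    leaves big gaps in all parts, and a map beta that stays surjective when
    restricted to some set leaving such gaps. Then every injection h factors
    as alpha p f q g r beta with f packing, g spreading and p, q, r in the
    stabiliser: alpha and beta create the room in which p, q, r can be chosen.
    This puts Sym(Omega) inside M, a contradiction.

    The map alpha exists for the following reason ([M_gappy_injection]). Let E
    be the family of the sets avoided by the image of some injection in M. The
    maps that carry complements of sets of E to complements of sets of E,
    whenever they are injective there, form a semigroup containing M; so it is
    M or everything. If it is everything, alpha is obtained at once. If it is
    M, then E is not invariant under Sym(Omega). But a family such as E,
    closed under an amalgamation rule coming from composition in M, is
    invariant under Sym(Omega) unless it has a member that is big in every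
    part ([avoid_dichotomy]). The map beta comes from the same dichotomy,
    applied to the sets whose complement is mapped onto Omega by some element
    of M. *)

(** * Infinite cardinals *)

Lemma card_leTP (T U : Type) (B : set U) :
  [set: T] #<= B <-> exists f : T -> U, injective f /\ forall x, B (f x).
Proof.
split=> [|[f [finj fB]]].
  elim/Ppointed: U => U in B *.
    move=> /card_leP[g].
    have T0 : T -> False.
      by move=> t; exact: (no (val (g (SigSub (mem_set (I : setT t)))))).
    by exists (fun t => False_rect _ (T0 t)); split=> t; case: (T0 t).
  move=> /pcard_leP[g]; exists g; split; last by move=> x; apply: funS.
  by move=> x y; apply: inj; rewrite inE.
apply: (@card_le_trans _ _ _ (f @` setT)).
  by rewrite (card_le_eqr (inj_card_eq (in2W finj))).
by apply: subset_card_le => _ [x _ <-].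
Qed.

Definition embeds (T : Type) (A B : set T) : Prop :=
  exists f : T -> T, (forall x, A x -> B (f x)) /\
    (forall x y, A x -> A y -> f x = f y -> x = y).

(** Comparability of cardinals: in a maximal partial injection from A to B,
    either A or B is exhausted. *)
Lemma embeds_total (T : Type) (A B : set T) : embeds A B \/ embeds B A.
Proof.
pose P (G : set (T * T)) := (forall p, G p -> A p.1 /\ B p.2) /\
  (forall p q, G p -> G q -> p.1 = q.1 <-> p.2 = q.2).
have [|G [[GAB Ginj] Gmax]] := @Zorn_bigcup (T * T) P.
  move=> F FP Ftot; split=> [p [G FG Gp]|p q [G FG Gp] [H FH Hq]].
    by have [+ _] := FP _ FG; apply.
  have [GH|HG] := Ftot _ _ FG FH.
    by have [_] := FP _ FH; apply=> //; apply: GH.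
  by have [_] := FP _ FG; apply=> //; apply: HG.
have [domG|/existsNP[x0 /not_implyP[Ax0 nGx0]]] :=
  pselect (forall x, A x -> exists y, G (x, y)).
  left; have /choice[f fP] : forall x, exists y, A x -> G (x, y).
    move=> x; have [Ax|nAx] := pselect (A x); last by exists x.
    by have [y Gxy] := domG _ Ax; exists y.
  exists f; split=> [x /fP /GAB[]//|x y /fP Gx /fP Gy fxy].
  by apply/(Ginj _ _ Gx Gy).
have [codG|/existsNP[y0 /not_implyP[By0 nGy0]]] :=
  pselect (forall y, B y -> exists x, G (x, y)).
  right; have /choice[f fP] : forall y, exists x, B y -> G (x, y).
    move=> x; have [Ax|nAx] := pselect (B x); last by exists x.
    by have [y Gxy] := codG _ Ax; exists y.
  exists f; split=> [x /fP /GAB[]//|x y /fP Gx /fP Gy fxy].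
  by apply/(Ginj _ _ Gx Gy).
case: (Gmax (G `|` [set (x0, y0)])).
  split; first by move=> p; left.
  by move=> /(_ (x0, y0)) Gxy; apply: nGx0; exists y0; apply: Gxy; right.
split=> [p [/GAB//|->//]|p q [Gp|->] [Gq|->]] //=; first exact: Ginj.
- split=> pq; [case: nGx0; exists p.2|case: nGy0; exists p.1];
    by rewrite -pq -surjective_pairing.
- split=> pq; [case: nGx0; exists q.2|case: nGy0; exists q.1];
    by rewrite pq -surjective_pairing.
Qed.

(** Twice an infinite cardinal is itself. A maximal family F of disjoint
    injective sequences in Y leaves only a finite set uncovered; since each
    sequence has room for any countable set of labels, the sequence through x
    can store both copies of x. The finite leftover is stored in one fixed
    sequence [f0]. *)
Lemma infinite_double (T : Type) (Y : set T) : infinite_set Y ->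
  exists d : bool -> T -> T, (forall b x, Y x -> Y (d b x)) /\
    (forall b b' x x', Y x -> Y x' -> d b x = d b' x' -> b = b' /\ x = x').
Proof.
move=> Yinf.
pose P (F : set (nat -> T)) := (forall f n, F f -> Y (f n)) /\
  (forall f g m n, F f -> F g -> f m = g n -> f = g /\ m = n).
have [|F [[FY Finj] Fmax]] := @Zorn_bigcup (nat -> T) P.
  move=> C CP Ctot; split=> [f n [F CF Ff]|f g m n [F CF Ff] [G CG Gg]].
    by have [+ _] := CP _ CF; apply.
  have [FG|GF] := Ctot _ _ CF CG.
    by have [_] := CP _ CG; apply=> //; apply: FG.
  by have [_] := CP _ CF; apply=> //; apply: GF.
pose S : set T := [set x | exists f n, F f /\ f n = x].
have Rfin : finite_set (Y `\` S).
  apply: contrapT => /infiniteP/card_leTP[g [ginj gR]].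
  case: (Fmax (F `|` [set g])).
    split; first by move=> p; left.
    move=> /(_ g) Fg; have {}Fg : F g by apply: Fg; right.
    by have [_] := gR 0%N; apply; exists g, 0%N.
  split=> [f n [/FY//|->]|f h m n [Ff|->] [Fh|->]].
  - by have [] := gR n.
  - exact: Finj.
  - by move=> fg; have [_] := gR n; case; exists f, m.
  - by move=> fg; have [_] := gR m; case; exists h, n.
  - by move=> /ginj.
have [f0 Ff0] : exists f, F f.
  apply: contrapT => /forallNP nF; apply: Yinf; apply: sub_finite_set Rfin.
  by move=> y Yy; split=> // -[f [n [/nF]]].
have /pcard_injP[rk rkinj] : countable (Y `\` S) by exact: finite_set_countable.
have /choice[c cP] : forall x, exists c : (nat -> T) * (bool * nat), Y x ->
    F c.1 /\ (if c.2.1 then c.1 c.2.2 = x else (Y `\` S) x /\ rk x = c.2.2).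
  move=> x; have [[f [n [Ff fn]]]|nS] := pselect (S x).
    by exists (f, (true, n)).
  by exists (f0, (false, rk x)).
(* [c x] is the sequence that hosts [x] together with a label telling whether
   [x] lies on it, and at which index, or is a leftover with a given rank. *)
exists (fun b x => (c x).1 (pickle (b, (c x).2))); split=> [b x /cP[? _]|].
  exact: FY.
move=> b b' x x' /cP[Fx cx] /cP[Fx' cx'] eqd.
have [cxx' /(pcan_inj pickleK)[-> tagxx']] := Finj _ _ _ _ Fx Fx' eqd.
split=> //; move: cx cx'; rewrite cxx' tagxx'; case: ifP => _.
  by move=> -> .
by move=> [Rx rx] [Rx' rx']; apply: rkinj; rewrite ?inE// rx rx'.
Qed.

Lemma card_eq_set_bij (T : Type) (A B : set T) :
  A #= B -> exists f : T -> T, set_bij A B f.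
Proof.
elim/Ppointed: T => T in A B *; last by move=> /card_set_bijP.
by exists id; split=> x; case: (no x).
Qed.

(** * Sets as large as the whole space *)

Section Big.
Variable Omega : Type.
Hypothesis Omega_infinite : infinite_set [set: Omega].
Implicit Types X Y A B : set Omega.

(** Having the cardinality of Omega, in the form in which it is produced and
    consumed below: an injection into X serves at once as a supply of points
    of X indexed by Omega. *)
Definition big X := exists a : Omega -> Omega, injective a /\ forall x, X (a x).

Lemma bigP X : big X <-> X #= [set: Omega].
Proof.
rewrite card_eqPle; split=> [bX|[_ /card_leTP//]].
by split; [exact: card_leT|apply/card_leTP].
Qed.

Lemma big_subset X Y : X `<=` Y -> big X -> big Y.
Proof. by move=> XY [a [ainj aX]]; exists a; split=> // x; apply: XY. Qed.

Lemma big_image X (f : Omega -> Omega) : injective f -> big X -> big (f @` X).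
Proof.
move=> finj [a [ainj aX]]; exists (f \o a); split; first exact: inj_comp.
by move=> x; exists (a x).
Qed.

(** Y is infinite, so it absorbs a second copy of itself, and with it the rest
    of Omega. *)
Lemma big_complement Y : embeds (~` Y) Y -> big Y.
Proof.
move=> [e [eY einj]].
have Yinf : infinite_set Y.
  move=> Yfin; apply: Omega_infinite.
  rewrite -(setvU Y) finite_setU; split=> //.
  have /eq_finite_set <- : e @` (~` Y) #= ~` Y.
    by apply: inj_card_eq => x y /set_mem Yx /set_mem Yy; apply: einj.
  by apply: sub_finite_set Yfin => _ [x Yx <-]; apply: eY.
have [d [dY dinj]] := infinite_double Yinf.
exists (fun x => if pselect (Y x) is left _ then d true x else d false (e x)).
split=> [x y|x]; last by case: pselect => [Yx|/eY Yx]; apply: dY.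
case: pselect => Yx; case: pselect => Yy /dinj.
- by case.
- by case=> //; apply: eY.
- by case=> //; apply: eY.
- by case; [exact: eY|exact: eY|move=> _; apply: einj].
Qed.

Lemma big_setU X Y : big (X `|` Y) -> big X \/ big Y.
Proof.
move=> [a [ainj aXY]]; have aE A : big (a @^-1` A) -> big A.
  by move=> /(big_image ainj); apply: big_subset => _ [x ? <-].
have [|] := embeds_total (~` (a @^-1` X)) (a @^-1` X).
  by move=> /big_complement /aE; left.
rewrite -[X in embeds X]setCK => /big_complement bX; right; apply: aE.
by apply: big_subset bX => x nX; have [] := aXY x.
Qed.

(** Pigeonhole for finite colourings, by iterating [big_setU]. *)
Lemma big_color (C : finType) (c : Omega -> C) X :
  big X -> exists k, big (X `&` [set x | c x = k]).
Proof.
move=> bX; suff: forall s : seq C, big (X `&` [set x | c x \in s]) ->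
    exists k, big (X `&` [set x | c x = k]).
  by apply; apply: big_subset bX => x Xx; split=> //=; exact: (mem_enum C).
elim=> [|k s IHs].
  by move=> [a [ainj aX]]; have [x _] := infinite_setN0 Omega_infinite;
    have [] := aX x.
move=> bs; have /big_setU[] : big ((X `&` [set x | c x = k]) `|`
    (X `&` [set x | c x \in s])).
- apply: big_subset bs => x [Xx]; rewrite /= inE.
  by move=> /orP[/eqP|]; [left|right].
- by exists k.
- exact: IHs.
Qed.

Lemma big_bij X Y : big X -> big Y ->
  exists fg : (Omega -> Omega) * (Omega -> Omega),
  [/\ forall x, X x -> Y (fg.1 x), forall y, Y y -> X (fg.2 y),
      forall x, X x -> fg.2 (fg.1 x) = x & forall y, Y y -> fg.1 (fg.2 y) = y].
Proof.
move=> /bigP bX /bigP /card_esym bY.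
have [f [fXY finj fsurj]] : exists f, set_bij X Y f.
  exact: card_eq_set_bij (card_eq_trans bX bY).
have /choice[g gP] : forall y, exists x, Y y -> X x /\ f x = y.
  move=> y; have [Yy|nYy] := pselect (Y y); last by exists y.
  by have [x Xx fx] := fsurj _ Yy; exists x.
exists (f, g); split=> /=; first exact: fXY.
- by move=> y /gP[].
- move=> x Xx; have [Xgx fgx] := gP _ (fXY _ Xx).
  by apply: finj; rewrite ?inE.
- by move=> y /gP[].
Qed.

End Big.

(** * Permutations with prescribed values on the parts *)

Section Extend.
Variables (Omega I : Type).

Definition extend (x y : I -> Omega) (c : Omega -> Omega) (z : Omega) : Omega :=
  if pselect (range x z) is left e then y (sval (cid2 e)) else c z.

Lemma extend_range x y c t : injective x -> extend x y c (x t) = y t.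
Proof.
move=> xinj; rewrite /extend; case: pselect => [e|[]]; last by exists t.
by case: cid2 => t' _ /= /xinj ->.
Qed.

Lemma extend_out x y c z : ~ range x z -> extend x y c z = c z.
Proof. by rewrite /extend; case: pselect. Qed.

(** Stated with x and y in symmetric roles, so that it serves for both
    cancellation laws of a permutation and its inverse. *)
Lemma extendK x y c c' : injective x -> injective y ->
  (forall z, ~ range x z -> ~ range y (c z) /\ c' (c z) = z) ->
  cancel (extend x y c) (extend y x c').
Proof.
move=> xinj yinj cK z; have [[t _ <-]|nz] := pselect (range x z).
  by rewrite !extend_range.
by have [ncz cz] := cK _ nz; rewrite !extend_out.
Qed.

End Extend.

(** The partition enters through coordinates: [part z] is the index of the
    part of z and [rem z] its position there, each part being a copy of Omega
    through [tau i]. Points of the form tau i (tau i0 x) and tau i (tau i1 x)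
    then give two disjoint big subsets of the part i. *)
Section Coordinates.
Variables (Omega : Type) (n : nat).
Variables (part : Omega -> 'I_n) (rem : Omega -> Omega).
Variable tau : 'I_n -> Omega -> Omega.
Hypothesis Omega_infinite : infinite_set [set: Omega].
Hypothesis part_tau : forall i x, part (tau i x) = i.
Hypothesis tauK : forall i, cancel (tau i) rem.
Hypothesis tau_rem : forall z, tau (part z) (rem z) = z.
Variables i0 i1 : 'I_n.
Hypothesis i01 : i0 <> i1.

Let Sg := fun i => [set z | part z = i].

(** A set that leaves a big gap in every part; the set itself may be small. *)
Definition gappy (X : set Omega) := forall i, big (Sg i `\` X).

Lemma tau_inj i : injective (tau i).
Proof. exact: can_inj (tauK i). Qed.

Lemma tau_eq i j x y : tau i x = tau j y -> i = j /\ x = y.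
Proof.
move=> e; have ij : i = j by rewrite -(part_tau i x) e part_tau.
by split=> //; move: e; rewrite ij => /tau_inj.
Qed.

Lemma big_part i : big (Sg i).
Proof. by exists (tau i); split=> [|x]; [exact: tau_inj|exact: part_tau]. Qed.

Lemma gappy_sub X Y : X `<=` Y -> gappy Y -> gappy X.
Proof.
by move=> XY mY i; apply: big_subset (mY i) => z [zi nY]; split=> // /XY.
Qed.

Lemma part_Stab p (s : 'S_n) : bijective p ->
  (forall z, part (p z) = s (part z)) -> Stab Sg p.
Proof.
move=> pbij ps; split=> // i; exists (s i).
apply/seteqP; split=> [_ [z <- <-]|z zi]; first exact: ps.
have [q pK qK] := pbij; exists (q z); last exact: qK.
by apply: (@perm_inj _ s); rewrite -ps qK.
Qed.

(** The gaps that the domain and the range leave in corresponding parts are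
    equinumerous, so the rest of each part can be matched as well. *)
Lemma extend_to_Stab (I : Type) (x y : I -> Omega) (s : 'S_n) :
  injective x -> injective y -> (forall t, part (y t) = s (part (x t))) ->
  gappy (range x) -> gappy (range y) ->
  exists p, [/\ Stab Sg p, forall z, part (p z) = s (part z) &
                forall t, p (x t) = y t].
Proof.
move=> xinj yinj xy mx my.
have /choice[c cP] i := big_bij (mx i) (my (s i)).
pose C z := (c (part z)).1 z; pose C' z := (c ((s^-1)%g (part z))).2 z.
have CP z : ~ range x z ->
    [/\ ~ range y (C z), C' (C z) = z & part (C z) = s (part z)].
  move=> nz; have [c1 _ c3 _] := cP (part z).
  have [pC nC] := c1 z (conj erefl nz); split=> //.
  by rewrite /C' pC permK c3.
have C'P z : ~ range y z -> ~ range x (C' z) /\ C (C' z) = z.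
  move=> nz; have [_ c2 _ c4] := cP ((s^-1)%g (part z)).
  have pz : (Sg (s ((s^-1)%g (part z))) `\` range y) z by rewrite permKV.
  have [pC nC] := c2 z pz; split=> //.
  by rewrite /C pC c4.
have pP z : part (extend x y C z) = s (part z).
  have [[t _ <-]|nz] := pselect (range x z); first by rewrite extend_range.
  by rewrite extend_out //; have [] := CP z nz.
have K1 : cancel (extend x y C) (extend y x C').
  by apply: extendK => // z /CP[].
have K2 : cancel (extend y x C') (extend x y C) by apply: extendK.
exists (extend x y C); split=> //; last by move=> t; apply: extend_range.
by apply: part_Stab pP; exists (extend y x C').
Qed.

(** Distinct parts cannot be mapped onto the same part, so the induced map on
    the finitely many indices is a permutation. *)
Lemma Stab_part p : Stab Sg p ->
  exists s : 'S_n, forall z, part (p z) = s (part z).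
Proof.
move=> [/bij_inj pinj pS].
have /choice[f fP] := pS.
have fpart z : part (p z) = f (part z).
  by have : (p @` Sg (part z)) (p z) by [exists z]; rewrite fP.
have finj : injective f.
  move=> i j fij; have [x _] := infinite_setN0 Omega_infinite.
  have : Sg (f j) (p (tau i x)) by rewrite /Sg /= fpart part_tau.
  by rewrite -fP => -[z zj /pinj ze]; rewrite -(part_tau i x) -ze zj.
by exists (perm finj) => z; rewrite permE.
Qed.

Lemma tau_tau_gappy i : gappy (range (tau i \o tau i0)).
Proof.
move=> j; exists (tau j \o tau i1); split.
  exact: inj_comp (@tau_inj _) (@tau_inj _).
move=> x; split; first exact: part_tau.
by case=> y _ /tau_eq[_ /tau_eq[/i01]].
Qed.

Lemma extend_perm (s : 'S_n) :
  exists p, Stab Sg p /\ forall z, part (p z) = s (part z).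
Proof.
have none (x : False -> Omega) : gappy (range x).
  by move=> i; apply: big_subset (big_part i) => z zi; split=> // -[[]].
have [|||||p [? ? _]] := @extend_to_Stab False (False_rect _) (False_rect _) s.
- by case.
- by case.
- by case.
- exact: none.
- exact: none.
- by exists p.
Qed.

(** When one more set Y t0 is added, the sets chosen so far are split in two
    halves; the two families of halves are disjoint, so Y t0 keeps a big piece
    outside one of them, and that family is retained. *)
Lemma disjoint_big (Y : 'I_n -> set Omega) : (forall t, big (Y t)) ->
  exists y : 'I_n -> Omega -> Omega, (forall t x, Y t (y t x)) /\
    (forall t t' x x', y t x = y t' x' -> t = t' /\ x = x').
Proof.
move=> bY.
suff: forall s : seq 'I_n, exists y : 'I_n -> Omega -> Omega,
    (forall t x, t \in s -> Y t (y t x)) /\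
    (forall t t' x x', t \in s -> t' \in s ->
      y t x = y t' x' -> t = t' /\ x = x').
  move=> /(_ (enum 'I_n))[y [yY yinj]].
  by exists y; split=> *; [apply: yY|apply: yinj]; rewrite ?mem_enum.
elim=> [|t0 s [y [yY yinj]]]; first by exists (fun=> id).
have [t0s|t0s] := boolP (t0 \in s).
  have sE t : (t \in t0 :: s) = (t \in s).
    by rewrite inE; case: eqP => // ->; rewrite t0s.
  by exists y; split=> *; [apply: yY|apply: yinj]; rewrite -?sE.
pose P i := [set z | exists t x, t \in s /\ y t (tau i x) = z].
have [i [a [ainj aY]]] : exists i, big (Y t0 `\` P i).
  have /(big_setU Omega_infinite)[b0|b1] :
      big ((Y t0 `\` P i0) `|` (Y t0 `\` P i1)).
  - apply: big_subset (bY t0) => z Yz.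
    have [[t [x [ts e]]]|nPz] := pselect (P i0 z); last by left.
    right; split=> // -[t' [x' [ts']]].
    by rewrite -e => /yinj[] // _ /tau_eq[/esym].
  - by exists i0.
  - by exists i1.
exists (fun t x => if t == t0 then a x else y t (tau i x)); split.
  move=> t x; rewrite inE; case: eqP => [->|_] /=; last exact: yY.
  by have [] := aY x.
move=> t t' x x'; rewrite !inE; case: eqP => [->|_] /=; case: eqP => [->|_] //=.
- by move=> _ _ /ainj.
- by move=> _ ts' ae; have [_ []] := aY x; exists t', x'.
- by move=> ts _ ae; have [_ []] := aY x'; exists t, x.
- by move=> ts ts' /yinj[] // -> /tau_inj.
Qed.

(** * The two semigroups A1 and A2 *)

Local Notation rhoS := (rho Sg).

Lemma rhoP f i j : rhoS f (i, j) <-> exists z : Omega -> Omega,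
  [/\ injective (f \o z), forall x, part (z x) = i &
      forall x, part (f (z x)) = j].
Proof.
split=> [/bigP[w [winj wP]]|[z [zinj zi zj]]]; last first.
  apply/bigP; exists (f \o z); split=> // x.
  by split; [exists (z x); [apply: zi|]|apply: zj].
have /choice[z zP] : forall x, exists z, part z = i /\ f z = w x.
  by move=> x; have [[z zi fz] _] := wP x; exists z.
have fz : f \o z = w by apply/funext => x; have [] := zP x.
exists z; split; first by rewrite fz.
  by move=> x; have [] := zP x.
by move=> x; have [_ ->] := zP x; have [] := wP x.
Qed.

(** The intermediate points of a big set of images are finitely coloured by
    their part, so a big set of them shares the part j. *)
Lemma rho_comp f g i k : rhoS (g \o f) (i, k) ->
  exists j, rhoS f (i, j) /\ rhoS g (j, k).
Proof.
move=> /rhoP[z [zinj zi zk]].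
have bT : big [set: Omega] by exists id; split.
have [j [v [vinj vj]]] := big_color Omega_infinite (part \o (f \o z)) bT.
exists j; split; apply/rhoP; [exists (z \o v)|exists (f \o (z \o v))]; split.
- by move=> x y /= e; apply: vinj; apply: zinj; rewrite /= e.
- by move=> x; apply: zi.
- by move=> x; have [_] := vj x.
- by move=> x y e; apply: vinj; apply: zinj.
- by move=> x; have [_] := vj x.
- by move=> x; apply: zk.
Qed.

Lemma perm_relE (s : 'S_n) i j : perm_rel s (i, j) = (s i = j).
Proof. by []. Qed.

Lemma rho_perm f (s : 'S_n) : (forall z, part (f z) = s (part z)) ->
  (forall i, big (f @` Sg i)) -> rhoS f = perm_rel s.
Proof.
move=> fs bf; apply/seteqP; split=> [[i j] /rhoP[z [_ zi zj]]|[i j]].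
  have [x _] := infinite_setN0 Omega_infinite.
  by have /= zjx := zj x; rewrite perm_relE -zjx fs zi.
rewrite perm_relE => <-; apply/bigP; apply: big_subset (bf i) => _ [z zi <-].
split; first by exists z.
by rewrite /Sg /= fs zi.
Qed.

Lemma rel_in_Sym_sub (r : set ('I_n * 'I_n)) (s : 'S_n) :
  r `<=` perm_rel s -> rel_total r -> rel_in_Sym r.
Proof.
move=> rs rtot; exists s; apply/seteqP; split=> // -[i j].
rewrite perm_relE => <-.
by have [k rik] := rtot i; have := rs _ rik; rewrite perm_relE => ->.
Qed.

Lemma rel_in_Sym_sub_inv (r : set ('I_n * 'I_n)) (s : 'S_n) :
  r `<=` perm_rel s -> rel_total (r^-1)%relation -> rel_in_Sym r.
Proof.
move=> rs rtot; exists s; apply/seteqP; split=> // -[i j].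
rewrite perm_relE => <-.
have [k /= rks] := rtot (s i); have := rs _ rks.
by rewrite perm_relE => /perm_inj ki; rewrite -[i in (i, _)]ki.
Qed.

Lemma A1_subsemigroup : subsemigroup (@map_mul Omega) (A1 Sg).
Proof.
move=> f g Af Ag; rewrite /A1 /map_mul /=.
have [tot|] := pselect (rel_total (rhoS (g \o f))); last by right.
case: Af => [[s fs]|nf]; last first.
  by case: nf => i; have [k /rho_comp[j [? _]]] := tot i; exists j.
case: Ag => [[s' gs]|ng]; last first.
  case: ng => j; have [k /rho_comp[j' []]] := tot ((s^-1)%g j).
  by rewrite fs perm_relE permKV => <-; exists k.
left; apply: (@rel_in_Sym_sub _ (s * s')%g) => // -[i k] /rho_comp[j []].
by rewrite fs gs !perm_relE permM => -> ->.
Qed.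

Lemma A2_subsemigroup : subsemigroup (@map_mul Omega) (A2 Sg).
Proof.
move=> f g Af Ag; rewrite /A2 /map_mul /=.
have [tot|] := pselect (rel_total (rhoS (g \o f))^-1%relation); last by right.
case: Ag => [[s' gs]|ng]; last first.
  by case: ng => i; have [k /rho_comp[j [_ ?]]] := tot i; exists j.
case: Af => [[s fs]|nf]; last first.
  case: nf => j; have [k /rho_comp[j' []]] := tot (s' j).
  by rewrite gs perm_relE => rkj /perm_inj <-; exists k.
left; apply: (@rel_in_Sym_sub_inv _ (s * s')%g) => // -[i k] /rho_comp[j []].
by rewrite fs gs !perm_relE permM => -> ->.
Qed.

Lemma Stab_rho p : Stab Sg p -> rel_in_Sym (rhoS p).
Proof.
move=> pS; have [s sP] := Stab_part pS; exists s; apply: rho_perm => // i.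
by apply: big_image (big_part i); apply: bij_inj; case: pS.
Qed.

Lemma Stab_A1 : Stab Sg `<=` A1 Sg.
Proof. by move=> p /Stab_rho; left. Qed.

Lemma Stab_A2 : Stab Sg `<=` A2 Sg.
Proof. by move=> p /Stab_rho; left. Qed.

(** Exchanging the piece j of the part i with the piece i of the part j gives
    an involution that connects every part with every part. *)
Lemma Sym_full_rho : exists f, SymSet f /\ rhoS f = setT.
Proof.
pose f z := tau (part (rem z)) (tau (part z) (rem (rem z))).
have fE i j v : f (tau i (tau j v)) = tau j (tau i v).
  by rewrite /f !tauK !part_tau.
exists f; split.
  exists f; by move=> z; rewrite -(tau_rem z) -(tau_rem (rem z)) !fE.
apply/seteqP; split=> // -[i j] _; apply/rhoP; exists (tau i \o tau j); split.
- by move=> x y; rewrite /= !fE => /tau_inj/tau_inj.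
- by move=> x; apply: part_tau.
- by move=> x; rewrite /= fE part_tau.
Qed.

Lemma full_not_Sym : ~ rel_in_Sym [set: 'I_n * 'I_n].
Proof.
move=> [s sP]; apply: i01.
have e k : [set: 'I_n * 'I_n] (i0, k) by [].
by have := e i0; have := e i1; rewrite sP !perm_relE => <-.
Qed.

Lemma A1_not_Sym : ~ (@SymSet Omega `<=` A1 Sg).
Proof.
have [f [fS frho]] := Sym_full_rho.
move=> /(_ f fS); rewrite /A1 /= frho => -[/full_not_Sym//|].
by apply=> i; exists i.
Qed.

Lemma A2_not_Sym : ~ (@SymSet Omega `<=` A2 Sg).
Proof.
have [f [fS frho]] := Sym_full_rho.
move=> /(_ f fS); rewrite /A2 /= frho => -[/full_not_Sym//|].
by apply=> i; exists i.
Qed.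

(** * Packing and spreading *)

(** If a choice function of the relation is a permutation, the relation has a
    further pair (i, j), and changing the value at i to j repeats a value. *)
Lemma total_not_Sym (r : set ('I_n * 'I_n)) : rel_total r -> ~ rel_in_Sym r ->
  exists phi : 'I_n -> 'I_n, (forall i, r (i, phi i)) /\ ~ injective phi.
Proof.
move=> /choice[phi rphi] nr.
have [phiinj|] := pselect (injective phi); last by exists phi.
have [[i j] [rij phij]] : exists p, r p /\ phi p.1 <> p.2.
  apply: contrapT => /forallNP nex; apply: nr.
  apply: (@rel_in_Sym_sub _ (perm phiinj)) => [[i j] rij|i]; last first.
    by exists (phi i).
  by rewrite perm_relE permE; apply: contrapT => ne; apply: (nex (i, j)).
have [psi phiK psiK] := injF_bij phiinj.
exists (fun k => if k == i then j else phi k); split.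
  by move=> k; case: eqP => [->|].
have psij : psi j != i.
  by apply/eqP => e; apply: phij; rewrite /= -e psiK.
by move=> /(_ i (psi j)); rewrite eqxx (negbTE psij) psiK => /(_ erefl)/eqP;
  rewrite eq_sym (negbTE psij).
Qed.

(** Synchronisation: if a map in the monoid takes the value c on a list of
    indices and another value at i, a permutation moves these two values to a
    pair that phi identifies. *)
Lemma collapse_to_constant (T : set ('I_n -> 'I_n)) (phi : 'I_n -> 'I_n)
    (k : 'I_n) :
  (forall f g, T f -> T g -> T (g \o f)) -> (forall s : 'S_n, T s) ->
  T phi -> ~ injective phi -> T (fun=> k).
Proof.
move=> Tcomp Tperm Tphi /existsNP[j1 /existsNP[j2 /not_implyP[phij j12]]].
suff: forall l : seq 'I_n, exists f c, T f /\ {in l, forall i, f i = c}.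
  move=> /(_ (enum 'I_n))[f [c [Tf fc]]].
  rewrite (_ : (fun=> k) = tperm c k \o f); first exact: Tcomp.
  by apply/funext => i /=; rewrite fc ?mem_enum// tpermL.
elim=> [|i l [f [c [Tf fc]]]]; first by exists (1%g : 'S_n), k.
have [fic|fic] := eqVneq (f i) c.
  by exists f, c; split=> // j; rewrite inE => /orP[/eqP->|/fc].
pose s := (tperm c j1 * tperm (tperm c j1 (f i)) j2)%g.
have sc : s c = j1.
  rewrite permM tpermL tpermD //; last by apply/eqP => /esym.
  by rewrite -[X in _ != X](tpermL c j1) (inj_eq perm_inj).
have sfi : s (f i) = j2 by rewrite permM tpermL.
exists (phi \o (s \o f)), (phi j1); split.
  by apply: (Tcomp _ _ _ Tphi); apply: (Tcomp _ _ Tf); apply: Tperm.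
by move=> j; rewrite inE /= => /orP[/eqP->|/fc->]; rewrite ?sfi ?sc.
Qed.

(** Sources and targets are indexed by the same t, so that one notion covers
    packing (s = id and d constant) and spreading (s constant and d = id). The
    two gap conditions leave the stabiliser the room to adjust both ends,
    which makes composition possible. *)
Definition realizes (U : set (Omega -> Omega)) (s d : 'I_n -> 'I_n) :=
  exists f (a : 'I_n * Omega -> Omega), U f /\
    [/\ forall p, part (a p) = s p.1, forall p, part (f (a p)) = d p.1,
        injective (f \o a), gappy (range a) & gappy (range (f \o a))].

Lemma gappy_shrink (b : 'I_n * Omega -> Omega) (d : 'I_n -> 'I_n) :
  injective b -> (forall p, part (b p) = d p.1) ->
  gappy (range (fun p => b (p.1, tau i0 p.2))).
Proof.
move=> binj bd i; have [[t ti]|ni] := pselect (exists t, d t = i).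
  exists (fun x => b (t, tau i1 x)); split=> [x y /binj[/tau_inj]//|x].
  split; first by rewrite /Sg /= bd.
  by move=> [[t' x'] _ /binj[_ /tau_eq[]]].
apply: big_subset (big_part i) => z zi; split=> // -[p _ bz].
by apply: ni; exists p.1; rewrite -zi -bz bd.
Qed.

(** Gaps come for free: halve each piece. *)
Lemma realizes_weak (U : set (Omega -> Omega)) (s d : 'I_n -> 'I_n) f
    (a : 'I_n * Omega -> Omega) : U f ->
  (forall p, part (a p) = s p.1) -> (forall p, part (f (a p)) = d p.1) ->
  injective (f \o a) -> realizes U s d.
Proof.
move=> Uf sa da fainj; exists f, (fun p => a (p.1, tau i0 p.2)); split=> //.
have ainj : injective a by apply: inj_compr fainj.
split.
- by move=> p /=; rewrite sa.
- by move=> p /=; rewrite da.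
- by move=> [t x] [t' x'] /fainj[-> /tau_inj->].
- exact: gappy_shrink sa.
- exact: gappy_shrink fainj da.
Qed.

(** A piece of index k is split into as many pieces as psi takes the value
    k. *)
Lemma realizes_reindex U s d (psi : 'I_n -> 'I_n) :
  realizes U s d -> realizes U (s \o psi) (d \o psi).
Proof.
move=> [f [a [Uf [sa da fainj _ _]]]].
apply: (@realizes_weak _ _ _ f (fun p => a (psi p.1, tau p.1 p.2))) => //.
by move=> [t x] [t' x'] /fainj[_ /tau_eq[-> ->]].
Qed.

Lemma realizes_rho U f s d : U f -> (forall t, rhoS f (s t, d t)) ->
  realizes U s d.
Proof.
move=> Uf fsd.
have [y [yP yinj]] := disjoint_big (fun t => (bigP _).2 (fsd t)).
have /choice[a aP] : forall p, exists z, part z = s p.1 /\ f z = y p.1 p.2.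
  by move=> p; have [[z zs fz] _] := yP p.1 p.2; exists z.
apply: (@realizes_weak _ _ _ f a) => //.
- by move=> p; have [] := aP p.
- by move=> p; have [_ ->] := aP p; have [] := yP p.1 p.2.
- move=> [t x] [t' x'] /=; have [_ ->] := aP (t, x); have [_ ->] := aP (t', x').
  by move=> /yinj[] /= -> ->.
Qed.

Section Over_Stab.
Variable U : set (Omega -> Omega).
Hypothesis U_mul : subsemigroup (@map_mul Omega) U.
Hypothesis U_Stab : Stab Sg `<=` U.

(** An element of the stabiliser lines up the pieces produced by the first map
    with those consumed by the second. *)
Lemma realizes_comp s m d : realizes U s m -> realizes U m d -> realizes U s d.
Proof.
move=> [f [a [Uf [sa ma fainj aM faM]]]] [g [b [Ug [mb db gbinj bM gbM]]]].
have binj : injective b by apply: inj_compr gbinj.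
have [|p [pS _ pfa]] := extend_to_Stab (s := 1%g) fainj binj _ faM bM.
  by move=> t; rewrite perm1 /= ma mb.
have fE : map_mul f (map_mul p g) \o a = g \o b.
  by apply/funext => t; have /= := pfa t => /= <-.
exists (map_mul f (map_mul p g)), a; rewrite fE; split.
  by apply: (U_mul Uf); apply: (U_mul _ Ug); apply: U_Stab.
split=> // t; have /= -> := congr1 (@^~ t) fE; exact: db.
Qed.

Lemma realizes_perm (s : 'S_n) : realizes U id s.
Proof.
have [p [pS ps]] := extend_perm s.
apply: (@realizes_weak _ _ _ p (fun t => tau t.1 t.2)).
- exact: U_Stab.
- by move=> t; apply: part_tau.
- by move=> t; rewrite ps part_tau.
- by move=> [t x] [t' x'] /(bij_inj pS.1) /tau_eq[] /= -> ->.
Qed.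

Lemma realizes_perm_inv (s : 'S_n) : realizes U s id.
Proof.
have := realizes_reindex s (realizes_perm (s^-1)%g).
by rewrite (_ : (s^-1)%g \o s = id)//; apply/funext => i /=; rewrite permK.
Qed.

(** The psi such that (id, psi) is realised form a monoid: reindexing turns
    the pattern (id, h) into (g, h \o g), which continues (id, g). *)
Lemma not_A1_realizes k : ~ (U `<=` A1 Sg) -> realizes U id (fun=> k).
Proof.
move=> /existsNP[f /not_implyP[Uf /not_orP[nperm /contrapT tot]]].
have [phi [rphi nphi]] := total_not_Sym tot nperm.
apply: (@collapse_to_constant [set psi | realizes U id psi] phi) => //=.
- move=> g h Ug Uh; apply: realizes_comp Ug _.
  exact: (realizes_reindex g Uh).
- exact: realizes_perm.
- exact: realizes_rho rphi.
Qed.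

Lemma not_A2_realizes k : ~ (U `<=` A2 Sg) -> realizes U (fun=> k) id.
Proof.
move=> /existsNP[f /not_implyP[Uf /not_orP[nperm /contrapT tot]]].
have [phi [rphi nphi]] : exists phi : 'I_n -> 'I_n,
    (forall i, ((rhoS f)^-1)%relation (i, phi i)) /\ ~ injective phi.
  apply: total_not_Sym tot _ => -[s sP]; apply: nperm.
  exists (s^-1)%g; apply/seteqP; split=> -[i j].
    move=> rij; have : perm_rel s (j, i) by rewrite -sP.
    by rewrite !perm_relE => <-; rewrite permK.
  rewrite perm_relE => <-.
  have : perm_rel s ((s^-1)%g i, i) by rewrite perm_relE permKV.
  by rewrite -sP.
apply: (@collapse_to_constant [set psi | realizes U psi id] phi) => //=.
- move=> g h Ug Uh; apply: realizes_comp Ug.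
  exact: (realizes_reindex g Uh).
- exact: realizes_perm_inv.
- exact: realizes_rho rphi.
Qed.

End Over_Stab.

(** * Maximality of A1 and A2 *)

(** Here h = al f be. The image of al f lies in the part i0, so be may be
    taken constant on the part i1, which puts it in A1 whatever h is. *)
Lemma A1_realizes_all (U : set (Omega -> Omega)) :
  subsemigroup (@map_mul Omega) U -> A1 Sg `<=` U ->
  realizes U id (fun=> i0) -> U = setT.
Proof.
move=> U_mul A1U [f [a [Uf [ida fa fainj _ _]]]]; apply/seteqP; split=> // h _.
have [w _] := infinite_setN0 Omega_infinite.
pose al x := a (part x, x); pose be := extend (f \o al) h (fun=> w).
have falinj : injective (f \o al) by move=> x y /fainj[].
have A1al : A1 Sg al.
  left; exists 1%g; apply: rho_perm => [x|i]; first by rewrite perm1 ida.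
  by apply: big_image (big_part i); apply: inj_compr falinj.
have A1be : A1 Sg be.
  right=> /(_ i1)[j /rhoP[z [zinj zi1 _]]].
  have bew x : be (z x) = w.
    apply: extend_out => -[y _ zx]; apply: i01.
    by rewrite -(zi1 x) -zx /= fa.
  have /tau_eq[]// : tau i0 w = tau i1 w.
  by apply: zinj; rewrite /= !bew.
have -> : h = map_mul (map_mul al f) be.
  by apply/funext => x; have /= := extend_range h (fun=> w) x falinj => /= <-.
exact: U_mul (U_mul _ _ (A1U _ A1al) Uf) (A1U _ A1be).
Qed.

(** Here h = ga f be, where be undoes the spreading f after a section ga that
    lands in the single part i0; ga lies in A2 because no big set reaches the
    part i1. *)
Lemma A2_realizes_all (U : set (Omega -> Omega)) :
  subsemigroup (@map_mul Omega) U -> A2 Sg `<=` U ->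
  realizes U (fun=> i0) id -> U = setT.
Proof.
move=> U_mul A2U [f [a [Uf [ida fa fainj _ _]]]]; apply/seteqP; split=> // h _.
pose b x := f (a (part x, x)); pose be := extend b id id.
have binj : injective b by move=> x y /fainj[].
have bpart x : part (b x) = part x by rewrite /b fa.
have A2be : A2 Sg be.
  left; exists 1%g; apply: rho_perm => [z|i]; rewrite ?perm1.
    have [[x _ <-]|nz] := pselect (range b z).
      by rewrite /be extend_range.
    by rewrite /be extend_out.
  apply: big_subset (big_part i) => z zi; exists (b z).
    by rewrite /Sg /= bpart.
  exact: extend_range.
pose ga x := a (part (h x), h x).
have A2ga : A2 Sg ga.
  right=> /(_ i1)[j /= /rhoP[z [_ _ gi1]]]; apply: i01.
  by have [w _] := infinite_setN0 Omega_infinite; rewrite -(gi1 w) ida.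
have -> : h = map_mul (map_mul ga f) be.
  by apply/funext => x; rewrite /be /map_mul /= (extend_range id id (h x) binj).
exact: U_mul (U_mul _ _ (A2U _ A2ga) Uf) (A2U _ A2be).
Qed.

Lemma generated_mul (G : set (Omega -> Omega)) :
  subsemigroup (@map_mul Omega) (generated_subsemigroup (@map_mul Omega) G).
Proof.
move=> f g Gf Gg V VP; case: (VP) => V_mul _.
exact: V_mul (Gf _ VP) (Gg _ VP).
Qed.

Lemma generatedU (A : set (Omega -> Omega)) s :
  A `<=` generated_subsemigroup (@map_mul Omega) (A `|` [set s]) /\
  generated_subsemigroup (@map_mul Omega) (A `|` [set s]) s.
Proof. by split=> [f Af|]; apply: sub_gen_smallest; [left|right]. Qed.

Lemma A1_maximal : maximal_subsemigroup (@map_mul Omega) (A1 Sg).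
Proof.
split; first exact: A1_subsemigroup.
  by move=> A1T; apply: A1_not_Sym; rewrite A1T.
move=> s ns; have [A1G Gs] := generatedU (A1 Sg) s.
apply: (A1_realizes_all (@generated_mul _) A1G).
apply: not_A1_realizes; first exact: generated_mul.
  exact: subset_trans Stab_A1 A1G.
by move=> /(_ s Gs).
Qed.

Lemma A2_maximal : maximal_subsemigroup (@map_mul Omega) (A2 Sg).
Proof.
split; first exact: A2_subsemigroup.
  by move=> A2T; apply: A2_not_Sym; rewrite A2T.
move=> s ns; have [A2G Gs] := generatedU (A2 Sg) s.
apply: (A2_realizes_all (@generated_mul _) A2G).
apply: not_A2_realizes; first exact: generated_mul.
  exact: subset_trans Stab_A2 A2G.
by move=> /(_ s Gs).
Qed.

Lemma maximal_sub (M N : set (Omega -> Omega)) :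
  maximal_subsemigroup (@map_mul Omega) M ->
  subsemigroup (@map_mul Omega) N -> M `<=` N -> M = N \/ N = setT.
Proof.
move=> [_ _ Mmax] N_mul MN.
have [NM|/existsNP[s /not_implyP[Ns nMs]]] := pselect (N `<=` M).
  by left; apply/seteqP.
right; apply/seteqP; split=> // f _.
have : generated_subsemigroup (@map_mul Omega) (M `|` [set s]) f.
  by rewrite Mmax.
by apply; split=> // g [/MN|->].
Qed.

(** * Families of avoidable sets *)

Lemma embeds_big X Y : big Y -> @embeds Omega X Y.
Proof. by move=> [a [ainj aY]]; exists a; split=> // x y _ _ /ainj. Qed.

Lemma big_embeds X Y : big X -> @embeds Omega X Y -> big Y.
Proof.
move=> [a [ainj aX]] [e [eY einj]]; exists (e \o a); split=> x.
  by move=> y /einj e'; apply: ainj; apply: e'.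
exact: eY.
Qed.

Lemma small_gappy X i : ~ big (X `&` Sg i) -> big (Sg i `\` X).
Proof.
move=> nb; have /(big_setU Omega_infinite)[] // :
    big ((X `&` Sg i) `|` (Sg i `\` X)).
apply: big_subset (big_part i) => z zi.
by have [|] := pselect (X z); [left|right].
Qed.

Lemma gappy_in_part X i : X `<=` Sg i -> big (Sg i `\` X) -> gappy X.
Proof.
move=> Xi bX j; have [<-//|ij] := eqVneq i j.
apply: big_subset (big_part j) => z zj; split=> // /Xi zi.
by move: ij; rewrite -zi -zj eqxx.
Qed.

(** An embedding into Y either leaves a big gap already, or shows that Y is
    big, in which case X can be embedded into one half of Y. *)
Lemma embeds_gappy X Y j : Y `<=` Sg j -> embeds X Y ->
  exists t : Omega -> Omega, [/\ forall x, X x -> Y (t x),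
    forall x y, X x -> X y -> t x = t y -> x = y & big (Sg j `\` t @` X)].
Proof.
move=> Yj [t [tY tinj]].
have [bt|/small_gappy bt] := pselect (big (t @` X `&` Sg j)); last by exists t.
have [a [ainj aY]] : big Y by apply: big_subset bt => _ [[x /tY ? <-]].
exists (a \o tau i0); split.
- by move=> x _; apply: aY.
- by move=> x y _ _ /ainj /tau_inj.
- exists (a \o tau i1); split; first exact: inj_comp (@tau_inj _).
  move=> x; split; first exact/Yj/aY.
  by move=> [y _ /ainj /tau_eq[]].
Qed.

Lemma Stab_inv p : Stab Sg p ->
  exists q, [/\ Stab Sg q, cancel p q & cancel q p].
Proof.
move=> pS; have [s ps] := Stab_part pS; have [[q pK qK] _] := pS.
exists q; split=> //; apply: (@part_Stab _ (s^-1)%g); first by exists p.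
by move=> z; apply: (@perm_inj _ s); rewrite permKV -ps qK.
Qed.

(** An abstract account of what the sets avoided by the injections in a
    semigroup above the stabiliser have in common with their duals for
    surjections. The rule [E_add] is the trace of composition: after a map
    that handles A, a map that handles B also takes care of every F that the
    first map places over B; r is the inverse of the injection that avoids A,
    or the surjection itself. *)
Section Avoidable.
Variable E : set (set Omega).
Hypothesis E_set0 : E set0.
Hypothesis E_subset : forall A B, A `<=` B -> E B -> E A.
Hypothesis E_Stab : forall p A, Stab Sg p -> E A -> E (p @^-1` A).
Hypothesis E_add : forall A, E A -> exists r : Omega -> Omega,
  forall B F, E B -> (forall x, F x -> B (r x)) -> E (A `|` F).

(** Up to the stabiliser, only the number of points in each part counts, as
    long as big gaps remain. *)
Lemma avoid_transfer (s : 'S_n) X Y : E Y -> gappy X ->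
  (forall i, embeds (X `&` Sg i) (Y `&` Sg (s i))) -> E X.
Proof.
move=> EY mX eXY.
have /choice[t tP] i := embeds_gappy (@subIsetr _ _ _) (eXY i).
pose y z := t (part z) z.
have yP z : X z -> Y (y z) /\ part (y z) = s (part z).
  by move=> Xz; have [+ _ _] := tP (part z); apply.
have yinj z w : X z -> X w -> y z = y w -> z = w.
  move=> Xz Xw e; have zw : part z = part w.
    by apply: (@perm_inj _ s); rewrite -(yP _ Xz).2 -(yP _ Xw).2 e.
  have [_ + _] := tP (part z); apply=> //.
  by move: e; rewrite /y zw.
have [|||||p [pS _ pt]] := @extend_to_Stab {z | X z} sval (y \o sval) s.
- by move=> [z Xz] [w Xw] /= e; apply: eq_exist.
- by move=> [z Xz] [w Xw] /= /(yinj _ _ Xz Xw) e; apply: eq_exist.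
- by move=> [z Xz]; have [] := yP _ Xz.
- by apply: gappy_sub mX => _ [[z Xz] _ <-].
- move=> j; have [_ _] := tP ((s^-1)%g j); rewrite permKV.
  apply: big_subset => z [zj nz]; split=> // -[[w Xw] _ /= wz]; apply: nz.
  have [_ pw] := yP _ Xw; have wj : part w = (s^-1)%g j.
    by apply: (@perm_inj _ s); rewrite permKV -pw wz.
  by exists w => //; rewrite -wz /y wj.
apply: E_subset (E_Stab pS EY) => z Xz.
by have := pt (exist _ z Xz) => /= ->; have [] := yP _ Xz.
Qed.

Lemma avoid_transfer_part X Y i j : E Y -> X `<=` Sg i -> big (Sg i `\` X) ->
  embeds X (Y `&` Sg j) -> E X.
Proof.
move=> EY Xi bX [t [tY tinj]].
apply: (@avoid_transfer (tperm i j) _ _ EY) => [|k].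
  exact: gappy_in_part Xi bX.
exists t; split=> [x [Xx xk]|x y [Xx _] [Xy _]]; last exact: tinj.
by have <- : i = k; [rewrite -xk (Xi _ Xx)|rewrite tpermL; apply: tY].
Qed.

(** Bigness spreads from one part to all. Once a member is big in some part,
    every subset of a single part that leaves a big gap there is a member. To
    make B big in the part k, colour the points of k outside B by the part and
    the half of that part in which [r] puts them: a big colour class F is
    placed by [r] over a set with a big gap, so F can be added. *)
Lemma avoid_big A k0 : E A -> big (A `&` Sg k0) ->
  exists A', E A' /\ forall k, big (A' `&` Sg k).
Proof.
move=> EA bA.
have EX X i : X `<=` Sg i -> big (Sg i `\` X) -> E X.
  by move=> Xi bX; apply: (avoid_transfer_part EA Xi bX); apply: embeds_big bA.
suff: forall l : seq 'I_n, exists B, E B /\ {in l, forall k, big (B `&` Sg k)}.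
  move=> /(_ (enum 'I_n))[B [EB bB]]; exists B; split=> // k.
  by apply: bB; rewrite mem_enum.
elim=> [|k l [B [EB bB]]]; first by exists set0.
have [bBk|/small_gappy bk] := pselect (big (B `&` Sg k)).
  by exists B; split=> // j; rewrite inE => /orP[/eqP->|/bB].
have [r rP] := E_add EB.
pose half z := part (rem z) == i0.
have half_big j c : big (Sg j `&` [set z | half z = c]).
  exists (tau j \o tau (if c then i0 else i1)); split.
    exact: inj_comp (@tau_inj _) (@tau_inj _).
  move=> x; split; first exact: part_tau.
  rewrite /half /= tauK part_tau; case: c; rewrite ?eqxx//.
  by apply/eqP => /esym.
have [[j c] bF] :=
  big_color Omega_infinite (fun x => (part (r x), half (r x))) bk.
set F := _ `&` _ in bF.
exists (B `|` F); split.
  apply: (rP (r @` F)); last by move=> x Fx; exists x.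
  apply: (EX _ j); first by move=> _ [x [_ [<- _]] <-].
  apply: big_subset (half_big j (~~ c)) => z [zj hz].
  split=> // -[x [_ [_ hx]] xz].
  by move: hz; rewrite /= -xz hx; case: (c).
move=> i; rewrite inE => /orP[/eqP->|/bB bi].
  by apply: big_subset bF => z [[zk nz] cz]; split=> //; right.
by apply: big_subset bi => z [Bz zi]; split=> //; left.
Qed.

(** The image of A under s is built up from the finitely many pieces F that
    come from a part i and lie in a part k. To add F to B, an equinumerous set
    phi F is chosen in the part k outside B, inside a big set that [r] puts
    over a single part; the image of phi F under [r] is no larger than the
    piece of A in the part i, hence a member. The stabiliser then moves B and
    phi F to B and F, because members leave a big gap in every part. *)
Lemma avoid_Sym (s s' : Omega -> Omega) A : cancel s s' -> cancel s' s ->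
  (forall B k, E B -> ~ big (B `&` Sg k)) -> E A -> E (s' @^-1` A).
Proof.
move=> sK s'K small EA.
suff: forall l : seq ('I_n * 'I_n),
    E [set y | A (s' y) /\ (part (s' y), part y) \in l].
  move=> /(_ (enum {: 'I_n * 'I_n})) El; apply: E_subset El => y Ay; split=> //.
  by rewrite mem_enum.
elim=> [|[i k] l EB]; first by apply: E_subset E_set0 => y [].
set B := [set y | _] in EB.
pose F := [set y | A (s' y) /\ part (s' y) = i /\ part y = k].
have [r rP] := E_add EB.
have [j [a [ainj aX]]] :=
  big_color Omega_infinite (part \o r) (small_gappy (small B k EB)).
pose phi y := a (tau i0 y).
have phiinj : injective phi by move=> x y /ainj /tau_inj.
have s'inj : injective s' by apply: can_inj s'K.
have EF : E (r @` (phi @` F)).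
  have eF : embeds (r @` (phi @` F)) (A `&` Sg i).
    have /choice[w wP] : forall y, exists w,
        (r @` (phi @` F)) y -> F w /\ r (phi w) = y.
      move=> y; have [[_ [w Fw <-] <-]|ny] := pselect ((r @` (phi @` F)) y).
        by exists w.
      by exists y.
    exists (s' \o w).
    split=> [y /wP[[? []]] //|x y /wP[_ rx] /wP[_ ry] /s'inj e].
    by rewrite -rx -ry e.
  apply: (@avoid_transfer_part _ _ j i EA _ _ eF).
    by move=> _ [_ [y _ <-] <-]; have [_] := aX (tau i0 y).
  apply: small_gappy => bF; apply: (small _ i EA); apply: big_embeds eF.
  by apply: big_subset bF => y [].
have EBF : E (B `|` phi @` F).
  by apply: rP EF _ => x Fx; exists x.
have nF : ~ big F.
  move=> bF; apply: (small _ i EA); apply: (big_embeds bF).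
  by exists s'; split=> [y [? []]|x y _ _ /s'inj].
apply: (@E_subset _ (B `|` F)).
  move=> y [Ay]; rewrite inE => /orP[/eqP[yi yk]|yl]; first by right.
  by left.
apply: (@avoid_transfer 1%g _ _ EBF).
  move=> i'; apply: small_gappy => bBF.
  have /(big_setU Omega_infinite)[bB|//] : big ((B `&` Sg i') `|` F).
    by apply: big_subset bBF => y [[By|Fy] yi']; [left|right].
  exact: small EB bB.
move=> i'; rewrite perm1.
have nB y : ~ B (phi y) by have [[_]] := aX (tau i0 y).
(* [phi] takes values outside [B], so keeping [B] and moving the rest of [F]
   is injective. *)
exists (fun y => if pselect (B y) is left _ then y else phi y); split.
  move=> y [[By|Fy] yi']; first by case: pselect => // _; split=> //; left.
  case: pselect => [By|_]; first by split=> //; left.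
  split; first by right; exists y.
  have [_ [_ yk]] := Fy; have [[ak _] _] := aX (tau i0 y).
  by rewrite -yi' yk; exact: ak.
move=> x y _ _; case: pselect => Bx; case: pselect => By //.
- by move=> e; case: (nB y); rewrite -e.
- by move=> e; case: (nB x); rewrite e.
- exact: phiinj.
Qed.

Lemma avoid_dichotomy : (exists A, E A /\ forall k, big (A `&` Sg k)) \/
  (forall s s' A, cancel s s' -> cancel s' s -> E A -> E (s' @^-1` A)).
Proof.
have [[A [k [EA bA]]]|nbig] := pselect (exists A k, E A /\ big (A `&` Sg k)).
  by left; apply: avoid_big EA bA.
right=> s s' A sK s'K; apply: (avoid_Sym sK s'K) => B k EB bB.
by apply: nbig; exists B, k.
Qed.

End Avoidable.

(** * Maximal subsemigroups above the stabiliser *)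

Section Maximal.
Variable M : set (Omega -> Omega).
Hypothesis M_max : maximal_subsemigroup (@map_mul Omega) M.
Hypothesis M_Stab : Stab Sg `<=` M.
Hypothesis M_not_Sym : ~ (@SymSet Omega `<=` M).

Lemma M_mul : subsemigroup (@map_mul Omega) M.
Proof. by case: M_max. Qed.

Lemma M_id : M id.
Proof.
apply: M_Stab; apply: (@part_Stab _ 1%g) => [|z]; last by rewrite perm1.
by exists id.
Qed.

(** W consists of the maps under which the images of injections from M remain,
    as long as injectivity lasts, supersets of images of injections from M. It
    is a semigroup above M, and it contains the permutations as soon as the
    family E of avoided sets is invariant under them. *)
Lemma M_gappy_injection :
  exists al, [/\ M al, injective al & gappy (range al)].
Proof.
pose W := [set f : Omega -> Omega | forall e, M e -> injective (f \o e) ->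
  exists e', [/\ M e', injective e' & range e' `<=` range (f \o e)]].
have W_mul : subsemigroup (@map_mul Omega) W.
  move=> f g Wf Wg e Me gfe.
  have feinj : injective (f \o e) by move=> x y /(congr1 g) /gfe.
  have [e1 [Me1 e1inj e1f]] := Wf e Me feinj.
  have [|e2 [Me2 e2inj e2g]] := Wg e1 Me1.
    move=> x y /= gxy; apply: e1inj.
    have [[x' _ ex] [y' _ ey]] : range (f \o e) (e1 x) /\ range (f \o e) (e1 y).
      by split; apply: e1f; [exists x|exists y].
    by rewrite -ex -ey; congr (f (e _)); apply: gfe;
      rewrite /map_mul /=; have /= -> := ex; have /= -> := ey.
  exists e2; split=> // _ [x _ <-].
  have [|y _ <-] := e2g (e2 x); first by exists x.
  have [|z _ ez] := e1f (e1 y); first by exists y.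
  by exists z => //=; rewrite -ez.
have MW : M `<=` W.
  by move=> f Mf e Me finj; exists (map_mul e f); split=> //; apply: M_mul.
have [MeW|WT] := maximal_sub M_max W_mul MW; last first.
  have : W (tau i0 \o tau i0) by rewrite WT.
  move=> /(_ _ M_id)[|e [Me einj er]].
    exact: inj_comp (@tau_inj _) (@tau_inj _).
  by exists e; split=> //; apply: gappy_sub er (@tau_tau_gappy _).
pose E := [set A : set Omega |
  exists e, [/\ M e, injective e & forall x, ~ A (e x)]].
have [||||[A [[e [Me einj nA]] bA]]|E_Sym] := @avoid_dichotomy E.
- by exists id; split=> [|x y //|x []//]; exact: M_id.
- by move=> A B AB [e [Me einj nB]]; exists e; split=> // x /AB; apply: nB.
- move=> p A /Stab_inv[q [qS pK qK]] [e [Me einj nA]].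
  exists (map_mul e q); split; first by apply: M_mul => //; apply: M_Stab.
    exact: inj_comp (can_inj qK) einj.
  by move=> x; rewrite /preimage /= /map_mul /= qK; apply: nA.
- move=> A [e [Me einj nA]].
  exists (extend e id id) => B F [e' [Me' e'inj nB]] FB.
  exists (map_mul e' e); split; first exact: M_mul.
    exact: inj_comp einj e'inj.
  move=> x [|/FB]; first exact: nA.
  by rewrite /map_mul /= extend_range//; apply: nB.
- exists e; split=> // k; apply: big_subset (bA k) => z [Az zk]; split=> //.
  by move=> [x _ ex]; apply: (nA x); rewrite ex.
- case: M_not_Sym; rewrite MeW => s [s' sK s'K] e Me seinj.
  have [|e' [Me' e'inj e's]] := E_Sym s s' (~` range e) sK s'K.
    by exists e; split=> // [|x]; [exact: inj_compr seinj|apply; exists x].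
  exists e'; split=> // _ [x _ <-].
  have [y _ ey] : range e (s' (e' x)) by apply: contrapT; exact: e's.
  by exists y => //=; rewrite ey s'K.
Qed.

(** Dual to [M_gappy_injection]: W consists of the maps f such that C can be
    mapped onto Omega from within M whenever its image under f can. *)
Lemma M_gappy_surjection : exists be C,
  [/\ M be, gappy C & forall y, exists x, C x /\ be x = y].
Proof.
pose W := [set f : Omega -> Omega | forall C : set Omega,
  (exists g, M g /\ forall y, exists x, C x /\ g (f x) = y) ->
  exists g, M g /\ forall y, exists x, C x /\ g x = y].
have W_mul : subsemigroup (@map_mul Omega) W.
  move=> f h Wf Wh C [g [Mg gsurj]].
  have [|g' [Mg' g'surj]] := Wh (f @` C).
    exists g; split=> // y; have [x [Cx gx]] := gsurj y.
    by exists (f x); split=> //; exists x.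
  apply: Wf; exists g'; split=> // y.
  by have [_ [[x Cx <-] gx]] := g'surj y; exists x.
have MW : M `<=` W.
  move=> f Mf C [g [Mg gsurj]]; exists (map_mul f g); split=> //.
  exact: M_mul.
have jinj := inj_comp (@tau_inj i0) (@tau_inj i0).
have [MeW|WT] := maximal_sub M_max W_mul MW; last first.
  have : W (extend (tau i0 \o tau i0) id id) by rewrite WT.
  move=> /(_ (range (tau i0 \o tau i0)))[|g [Mg gsurj]].
    exists id; split=> [|y]; first exact: M_id.
    exists ((tau i0 \o tau i0) y).
    by rewrite extend_range//; split=> //; exists y.
  exists g, (range (tau i0 \o tau i0)); split=> //; exact: tau_tau_gappy.
pose E := [set A : set Omega |
  exists g, M g /\ forall y, exists x, ~ A x /\ g x = y].
have [||||[A [[g [Mg gsurj]] bA]]|E_Sym] := @avoid_dichotomy E.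
- by exists id; split=> [|y]; [exact: M_id|exists y; split].
- move=> A B AB [g [Mg gsurj]]; exists g; split=> // y.
  by have [x [nBx gx]] := gsurj y; exists x; split=> // /AB.
- move=> p A pS [g [Mg gsurj]]; have [q [_ _ qK]] := Stab_inv pS.
  exists (map_mul p g); split; first by apply: M_mul => //; apply: M_Stab.
  move=> y; have [x [nAx gx]] := gsurj y.
  by exists (q x); rewrite /preimage /map_mul /= qK.
- move=> A [g [Mg gsurj]]; exists g => B F [g' [Mg' g'surj]] FB.
  exists (map_mul g g'); split; first exact: M_mul.
  move=> y; have [x' [nB gx']] := g'surj y; have [x [nA gx]] := gsurj x'.
  exists x; rewrite /map_mul /= gx; split=> // -[//|/FB].
  by rewrite gx.
- exists g, (~` A); split=> // k; apply: big_subset (bA k) => z [Az zk].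
  by split=> // nA; apply: nA.
- case: M_not_Sym; rewrite MeW => s [s' sK s'K] C [g [Mg gsurj]].
  have [|g' [Mg' g'surj]] := E_Sym s' s (s' @^-1` (~` C)) s'K sK.
    exists g; split=> // y; have [x [Cx gx]] := gsurj y.
    by exists (s x); split=> //; rewrite /preimage /= sK; apply.
  exists g'; split=> // y; have [x [nCx gx]] := g'surj y.
  by exists x; split=> //; move: nCx; rewrite /preimage /= sK => /contrapT.
Qed.

(** If M were contained in neither, every bijection h would be the product al
    p f q g r be: al makes room, p f packs everything into the part i0, where
    q is free to rearrange the points arbitrarily, and g r be spreads them out
    so that x arrives at a point [c (h x)] above h x. *)
Lemma maximal_sub_A1_or_A2 : M `<=` A1 Sg \/ M `<=` A2 Sg.
Proof.
apply: contrapT => /not_orP[nA1 nA2]; apply: M_not_Sym => h /bij_inj hinj.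
have [al [Mal alinj alM]] := M_gappy_injection.
have [be [C [Mbe CM /choice[c cP]]]] := M_gappy_surjection.
have [f [a [Mf [ida fa fainj aM faM]]]] := not_A1_realizes M_mul M_Stab i0 nA1.
have [g [b [Mg [idb gb gbinj bM gbM]]]] := not_A2_realizes M_mul M_Stab i0 nA2.
have ainj : injective a by apply: inj_compr fainj.
have binj : injective b by apply: inj_compr gbinj.
have cinj : injective c by move=> x y e; rewrite -(cP x).2 -(cP y).2 e.
pose x1 x := a (part (al x), x); pose x2 x := b (part (c (h x)), x).
have [||||p [pS _ pE]] := @extend_to_Stab _ al x1 1%g alinj.
- by move=> x y /ainj[].
- by move=> x; rewrite perm1 ida.
- exact: alM.
- by apply: gappy_sub aM => _ [x _ <-]; exists (part (al x), x).
have [||||| q [qS _ qE]] := @extend_to_Stab _ (f \o x1) x2 1%g.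
- by move=> x y /fainj[].
- by move=> x y /binj[].
- by move=> x; rewrite perm1 /= fa idb.
- by apply: gappy_sub faM => _ [x _ <-]; exists (part (al x), x).
- by apply: gappy_sub bM => _ [x _ <-]; exists (part (c (h x)), x).
have [||||| r [rS _ rE]] := @extend_to_Stab _ (g \o x2) (c \o h) 1%g.
- by move=> x y /gbinj[].
- exact: inj_comp.
- by move=> x; rewrite perm1 /= gb.
- by apply: gappy_sub gbM => _ [x _ <-]; exists (part (c (h x)), x).
- by apply: gappy_sub CM => _ [x _ <-]; have [] := cP (h x).
have -> : h = map_mul (map_mul (map_mul
    (map_mul (map_mul (map_mul al p) f) q) g) r) be.
  apply/funext => x; rewrite /map_mul /= pE.
  have /= -> := qE x; have /= -> := rE x.
  by have [_ ->] := cP (h x).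
apply: (M_mul _ Mbe); apply: (M_mul _ (M_Stab rS)).
apply: (M_mul _ Mg); apply: (M_mul _ (M_Stab qS)).
exact: M_mul (M_mul Mal (M_Stab pS)) Mf.
Qed.

End Maximal.

Lemma maximal_over_Stab :
  [set M : set (Omega -> Omega) |
     [/\ maximal_subsemigroup (@map_mul Omega) M, Stab Sg `<=` M &
         ~ (@SymSet Omega `<=` M)]] = [set A1 Sg; A2 Sg].
Proof.
have proper A : ~ (@SymSet Omega `<=` A) -> A <> setT.
  by move=> nA AT; apply: nA; rewrite AT.
apply/seteqP; split=> [M [M_max M_Stab M_not_Sym]|M [->|->]].
- have [MA|MA] := maximal_sub_A1_or_A2 M_max M_Stab M_not_Sym.
    have [->|/(proper _ A1_not_Sym)//] := maximal_sub M_max A1_subsemigroup MA.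
    by left.
  have [->|/(proper _ A2_not_Sym)//] := maximal_sub M_max A2_subsemigroup MA.
  by right.
- split; [exact: A1_maximal|exact: Stab_A1|exact: A1_not_Sym].
- split; [exact: A2_maximal|exact: Stab_A2|exact: A2_not_Sym].
Qed.

End Coordinates.

Lemma partition_coordinates (Omega : Type) (n : nat)
    (Sigma : 'I_n -> set Omega) :
  finite_partition Sigma ->
  exists (part : Omega -> 'I_n) (rem : Omega -> Omega)
      (tau : 'I_n -> Omega -> Omega),
    [/\ forall i x, part (tau i x) = i, forall i, cancel (tau i) rem,
        forall z, tau (part z) (rem z) = z &
        Sigma = fun i => [set z | part z = i]].
Proof.
move=> [_ [cov /trivIsetP triv _] cS].
have /choice[part partP] : forall z, exists i, Sigma i z.
  by move=> z; have : [set: Omega] z by []; rewrite -cov => -[i _ ?]; exists i.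
have partE i z : Sigma i z -> part z = i.
  move=> zi; apply: contrapT => /eqP ne; have := triv _ _ I I ne.
  by move/seteqP => [/(_ z) + _]; apply.
have /choice[tau tauP] i := card_eq_set_bij (card_esym (cS i)).
have /choice[rem remP] : forall z, exists x, tau (part z) x = z.
  by move=> z; have [_ _ /(_ z (partP z))[x _ xz]] := tauP (part z); exists x.
have part_tau i x : part (tau i x) = i.
  by apply: partE; have [+ _ _] := tauP i; apply.
exists part, rem, tau; split=> //.
- move=> i x; have := remP (tau i x); rewrite part_tau.
  by have [_ + _] := tauP i; apply; rewrite inE.
- apply/funext => i; apply/seteqP; split=> z; first exact: partE.
  by move=> <-; apply: partP.
Qed.

Theorem theorem4 (Omega : Type) (n : nat) (Sigma : 'I_n -> set Omega)
    (Omega_infinite : infinite_set [set: Omega])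
    (Sigma_partition : finite_partition Sigma) :
  [set M : set (Omega -> Omega) |
     [/\ maximal_subsemigroup (@map_mul Omega) M,
         Stab Sigma `<=` M &
         ~ (@SymSet Omega `<=` M)]]
  = [set A1 Sigma; A2 Sigma].
Proof.
have [n_gt1 _ _] := Sigma_partition.
have [part [rem [tau [part_tau tauK tau_rem ->]]]] :=
  partition_coordinates Sigma_partition.
apply: (maximal_over_Stab Omega_infinite part_tau tauK tau_rem
  (i0 := Ordinal (ltnW n_gt1)) (i1 := Ordinal n_gt1)).
by move=> /(congr1 val).
Qed.
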